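(* Let $\epsilon\in(0,1)$, let $M$ be a positive integer, and let $H=[H_1,\dots,H_L]$ be an $m\times ML$ matrix with $L$ blocks $H_\ell\in\mathbb{R}^{m\times M}$ such that every column $h$ of $H$ satisfies $$\|h\|_2\le\big[2\sigma\sqrt{2\ln(2/\delta)}\big]^{-1}\quad\text{and}\quad\overline{\mathfrak r}_b(h)\le\tfrac12\qquad\text{with }\delta=\epsilon/(ML).$$ Consider the optimization problem $$ \mathfrak p_+[H]=2\min_{\lambda_\ell,\Upsilon^\ell,\upsilon^\ell,\rho}\left\{\rho:\ \begin{array}{l}\upsilon^\ell\ge0,\ \Upsilon^\ell=\{\Upsilon^\ell_k\in\mathbf S^{f_k}_+,k\le K\},\ \ell\le L,\\ \lambda_\ell+\phi_{\mathcal T}(\lambda[\Upsilon^\ell])+\sum_{j=1}^M\upsilon^\ell_j\le\rho,\ \ell\le L,\\[3pt] \begin{bmatrix}\lambda_\ell I_\nu&\tfrac12R_\ell^{1/2}BP\\ \tfrac12P^TB^TR_\ell^{1/2}&P^TA^TH_\ell\,\mathrm{Diag}\{\upsilon^\ell\}H_\ell^TAP+\sum_kT_k^{+,*}[\Upsilon^\ell_k]\end{bmatrix}\succeq0,\ \ell\le L\end{array}\right\} $$ with variables $\lambda_\ell\in\mathbb{R}$, $\upsilon^\ell\in\mathbb{R}^M$, $\Upsilon^\ell$, $\rho\in\mathbb{R}$. Then the polyhedral estimate $\widehat w^H$ with contrast matrix $H$ satisfies $$\mathrm{Risk}_\epsilon[\widehat w^H|\mathcal X]\le\mathfrak p_+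[H].$$
   Context: Notation: $\mathbf S^d$, $\mathbf S^d_+$: symmetric and positive semidefinite $d\times d$ matrices; $\succeq$ the semidefinite order; $[a_1;\dots;a_q]$ vertical concatenation; $\phi_{\mathcal C}(y)=\sup_{u\in\mathcal C}y^Tu$. Observation model: $\omega=A[\eta]x+\xi\in\mathbb{R}^m$, $A[\eta]=A+D[\eta]$, $D[\eta]=\sum_{\alpha=1}^q\eta_\alpha A_\alpha$, with given $A,A_1,\dots,A_q\in\mathbb{R}^{m\times n}$; $x\in\mathcal X$ is unknown, $\eta$ is a deterministic perturbation from $\mathcal U\subset\mathbb{R}^q$. The noise $\xi\sim P_x$ (the distribution may depend on $x$) is zero-mean sub-Gaussian for every $x\in\mathcal X$: $\mathbf E\{e^{t^T\xi}\}\le\exp(\tfrac{\sigma^2}2\|t\|_2^2)$ for all $t\in\mathbb{R}^m$, with given $\sigma>0$. The goal is to recover $Bx$, $B\in\mathbb{R}^{\nu\times n}$, in the norm $\|u\|=\max_{\ell\le L}\sqrt{u^TR_\ell u}$, $R_\ell\in\mathbf S^\nu_+$, $\sum_\ell R_\ell\succ0$. Signal set and uncertainty set are spectratopes: $\mathcal X=\{Py:y\in\mathcal Y\}$, $\mathcal Y=\{y\in\mathbb{R}^N:\exists t\in\mathcal T:\ T_k^2[y]\preceq t_kI_{f_k},\ k\le K\}$, $T_k[y]=\sum_{j=1}^Ny_jT^{jk}$, $T^{jk}\in\mathbf S^{f_k}$; $\mathcal U=\{Qv:v\in\mathcal V\}$, $\mathcal V=\{v\in\mathbb{R}^{M'}:\exists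 s\in\mathcal S:\ S_i^2[v]\preceq s_iI_{d_i},\ i\le L'\}$, $S_i[v]=\sum_{j=1}^{M'}v_jS^{ji}$, $S^{ji}\in\mathbf S^{d_i}$. Here $T_k^2[y]=(T_k[y])^2$ and similarly for $S_i$; $\mathcal T\subset\mathbb{R}^K_+$ and $\mathcal S\subset\mathbb{R}^{L'}_+$ are compact convex sets with nonempty interiors that are monotone ($0\le t'\le t\in\mathcal T$ implies $t'\in\mathcal T$, same for $\mathcal S$); and for every $y\ne0$ some $T_k[y]\neq0$, for every $v\ne0$ some $S_i[v]\ne0$. For $X\in\mathbf S^{f_k}$: $T_k^{+,*}[X]=[\mathrm{Tr}(XT^{ik}T^{jk})]_{i,j\le N}$; for $Y\in\mathbf S^{d_i}$: $S_i^{+,*}[Y]=[\mathrm{Tr}(YS^{ji}S^{j'i})]_{j,j'\le M'}$. For a collection $\Lambda=\{\Lambda_k\}_{k\le K}$ of symmetric matrices, $\lambda[\Lambda]=[\mathrm{Tr}(\Lambda_1);\dots;\mathrm{Tr}(\Lambda_K)]$, and similarly for other collections. For $h\in\mathbb{R}^m$ let $A[h]=[h^TA_1;\dots;h^TA_q]\in\mathbb{R}^{q\times n}$ and $$\overline{\mathfrak r}_b(h)=\min_{\Lambda,\Upsilon}\left\{\tfrac12[\phi_{\mathcal T}(\lambda[\Lambda])+\phi_{\mathcal S}(\lambda[\Upsilon])]:\ \begin{array}{l}\Lambda=\{\Lambda_k\in\mathbf S^{f_k}_+,k\le K\},\ \Upsilon=\{\Upsilon_i\in\mathbf S^{d_i}_+,i\le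 L'\},\\ \begin{bmatrix}\sum_iS_i^{+,*}[\Upsilon_i]&Q^TA[h]P\\P^TA^T[h]Q&\sum_kT_k^{+,*}[\Lambda_k]\end{bmatrix}\succeq0\end{array}\right\}.$$ Polyhedral estimate: $\widehat x^H(\omega)\in\mathrm{Argmin}_{u\in\mathcal X}\|H^T[Au-\omega]\|_\infty$, $\widehat w^H(\omega)=B\widehat x^H(\omega)$. Risk: $\mathrm{Risk}_\epsilon[\widehat w|\mathcal X]=\sup_{x\in\mathcal X,\eta\in\mathcal U}\inf\{\rho:\mathrm{Prob}_{\xi\sim P_x}\{\|\widehat w(A[\eta]x+\xi)-Bx\|>\rho\}\le\epsilon\}$. *)

(* Defs.v *)
From mathcomp Require Import all_boot all_order all_algebra.
From mathcomp Require Import all_classical all_reals all_analysis.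

Set Implicit Arguments.
Unset Strict Implicit.
Unset Printing Implicit Defensive.

Import Order.TTheory GRing.Theory Num.Theory.
Import numFieldNormedType.Exports.

Local Open Scope classical_set_scope.
Local Open Scope ring_scope.

(* Vectors of R^d are columns 'cV[R]_d. *)

Definition dotv (R : realType) d (u v : 'cV[R]_d) : R := (u^T *m v) 0 0.

(* The library norm `|v| on 'cV[R]_d is the sup norm. *)
Definition norm2 (R : realType) d (v : 'cV[R]_d) : R := Num.sqrt (dotv v v).

Definition qform (R : realType) d (A : 'M[R]_d) (u : 'cV[R]_d) : R :=
  (u^T *m A *m u) 0 0.

Definition symmx (R : realType) d (A : 'M[R]_d) : Prop := A^T = A.

Definition psdmx (R : realType) d (A : 'M[R]_d) : Prop :=
  symmx A /\ forall u, 0 <= qform A u.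

Definition pdmx (R : realType) d (A : 'M[R]_d) : Prop :=
  symmx A /\ forall u, u != 0 -> 0 < qform A u.

Definition loewner_le (R : realType) d (A B : 'M[R]_d) : Prop := psdmx (B - A).

(* For A positive semidefinite, A^{1/2} is the positive semidefinite matrix
   whose square is A; it exists and is unique, so [get] selects it. *)
Definition sqrtmx (R : realType) d (A : 'M[R]_d) : 'M[R]_d :=
  get [set S : 'M[R]_d | psdmx S /\ S *m S = A].

(* sup_{u in C} y^T u as a real number; [sup] is the supremum only for C
   nonempty with y^T u bounded on C, in particular for the nonempty compact C
   used below. *)
Definition support_fun (R : realType) d (C : set 'cV[R]_d) (y : 'cV[R]_d) : R :=
  sup [set dotv y u | u in C].

(* lambda[Lambda] *)
Definition trvec (R : realType) K (f : 'I_K -> nat)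
    (La : forall k, 'M[R]_(f k)) : 'cV[R]_K :=
  \col_k \tr (La k).

(* The coefficient T^{jk} of y_j in T_k[y] is [T k j]. *)
Definition spec_lin (R : realType) N K (f : 'I_K -> nat)
    (T : forall k, 'I_N -> 'M[R]_(f k)) (k : 'I_K) (y : 'cV[R]_N) : 'M[R]_(f k) :=
  \sum_(j < N) y j 0 *: T k j.

(* T_k^{+,*}[X] *)
Definition spec_adj (R : realType) N K (f : 'I_K -> nat)
    (T : forall k, 'I_N -> 'M[R]_(f k)) (k : 'I_K) (X : 'M[R]_(f k)) : 'M[R]_N :=
  \matrix_(i, j) \tr (X *m T k i *m T k j).

Definition basic_spectratope (R : realType) N K (f : 'I_K -> nat)
    (T : forall k, 'I_N -> 'M[R]_(f k)) (TT : set 'cV[R]_K) : set 'cV[R]_N :=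
  [set y | exists2 t, TT t &
     forall k, loewner_le (spec_lin T k y *m spec_lin T k y) (t k 0)%:M].

Definition spectratope (R : realType) n N (P : 'M[R]_(n, N)) K (f : 'I_K -> nat)
    (T : forall k, 'I_N -> 'M[R]_(f k)) (TT : set 'cV[R]_K) : set 'cV[R]_n :=
  [set P *m y | y in basic_spectratope T TT].

Definition spectratope_data (R : realType) N K (f : 'I_K -> nat)
    (T : forall k, 'I_N -> 'M[R]_(f k)) (TT : set 'cV[R]_K) : Prop :=
  [/\ forall k j, symmx (T k j),
      forall y : 'cV[R]_N, y != 0 -> exists k, spec_lin T k y != 0,
      forall t, TT t -> forall k, 0 <= t k 0,
      forall t t' : 'cV[R]_K, TT t -> (forall k, 0 <= t' k 0 <= t k 0) -> TT t' &
      [/\ compact TT, convex_set TT & TT° !=set0]].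

(* D[eta] *)
Definition pert (R : realType) m n q (Aa : 'I_q -> 'M[R]_(m, n))
    (eta : 'cV[R]_q) : 'M[R]_(m, n) :=
  \sum_(a < q) eta a 0 *: Aa a.

(* A[h] *)
Definition contrast_mx (R : realType) m n q (Aa : 'I_q -> 'M[R]_(m, n))
    (h : 'cV[R]_m) : 'M[R]_(q, n) :=
  \matrix_(a < q) (h^T *m Aa a).

(* The objective values at the feasible points of the problem defining
   \bar r_b(h). *)
Definition rbar_vals (R : realType) m n q N K (f : 'I_K -> nat) M' L' (d : 'I_L' -> nat)
    (Aa : 'I_q -> 'M[R]_(m, n))
    (P : 'M[R]_(n, N)) (T : forall k, 'I_N -> 'M[R]_(f k)) (TT : set 'cV[R]_K)
    (Q : 'M[R]_(q, M')) (S : forall i, 'I_M' -> 'M[R]_(d i)) (SS : set 'cV[R]_L')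
    (h : 'cV[R]_m) : set R :=
  [set r |
    exists La : forall k, 'M[R]_(f k), exists Up : forall i, 'M[R]_(d i),
    [/\ forall k, psdmx (La k),
        forall i, psdmx (Up i),
        psdmx (block_mx
          (\sum_(i < L') spec_adj S (Up i))       (Q^T *m contrast_mx Aa h *m P)
          (P^T *m (contrast_mx Aa h)^T *m Q)      (\sum_(k < K) spec_adj T (La k))) &
        r = 2^-1 * (support_fun TT (trvec La) + support_fun SS (trvec Up))]].

Definition rbar (R : realType) m n q N K (f : 'I_K -> nat) M' L' (d : 'I_L' -> nat)
    (Aa : 'I_q -> 'M[R]_(m, n))
    (P : 'M[R]_(n, N)) (T : forall k, 'I_N -> 'M[R]_(f k)) (TT : set 'cV[R]_K)
    (Q : 'M[R]_(q, M')) (S : forall i, 'I_M' -> 'M[R]_(d i)) (SS : set 'cV[R]_L')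
    (h : 'cV[R]_m) : \bar R :=
  ereal_inf [set r%:E | r in rbar_vals Aa P T TT Q S SS h].

(* The values rho feasible in the problem defining p_+[H], with H_l = H l. *)
Definition pplus_feas (R : realType) m n nu N K (f : 'I_K -> nat) L M
    (A : 'M[R]_(m, n)) (B : 'M[R]_(nu, n)) (Rl : 'I_L -> 'M[R]_nu)
    (P : 'M[R]_(n, N)) (T : forall k, 'I_N -> 'M[R]_(f k)) (TT : set 'cV[R]_K)
    (H : 'I_L -> 'M[R]_(m, M)) : set R :=
  [set rho |
    exists lam : 'I_L -> R,
    exists Up : 'I_L -> forall k, 'M[R]_(f k),
    exists ups : 'I_L -> 'rV[R]_M,
    forall l : 'I_L,
    [/\ forall j, 0 <= ups l 0 j,
        forall k, psdmx (Up l k),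
        lam l + support_fun TT (trvec (Up l)) + \sum_(j < M) ups l 0 j <= rho &
        psdmx (block_mx
          (lam l)%:M                              (2^-1 *: (sqrtmx (Rl l) *m B *m P))
          (2^-1 *: (P^T *m B^T *m sqrtmx (Rl l)))
          (P^T *m A^T *m H l *m diag_mx (ups l) *m (H l)^T *m A *m P
             + \sum_(k < K) spec_adj T (Up l k)))]].

Definition pplus (R : realType) m n nu N K (f : 'I_K -> nat) L M
    (A : 'M[R]_(m, n)) (B : 'M[R]_(nu, n)) (Rl : 'I_L -> 'M[R]_nu)
    (P : 'M[R]_(n, N)) (T : forall k, 'I_N -> 'M[R]_(f k)) (TT : set 'cV[R]_K)
    (H : 'I_L -> 'M[R]_(m, M)) : \bar R :=
  (2%:E * ereal_inf [set rho%:E | rho in pplus_feas A B Rl P T TT H])%E.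

(* ||u|| = max_l sqrt(u^T R_l u); the base value 0 of the iterated maximum is
   irrelevant when L > 0. *)
Definition maxnorm (R : realType) nu L (Rl : 'I_L -> 'M[R]_nu) (u : 'cV[R]_nu) : R :=
  \big[Num.max/0]_(l < L) Num.sqrt (qform (Rl l) u).

(* R^m with its Borel sigma-algebra. *)
Notation borel_cV R m := (g_sigma_algebraType (@open 'cV[R]_m)).

Definition zero_mean (R : realType) m (mu : probability (borel_cV R m) R) : Prop :=
  forall i : 'I_m,
    mu.-integrable setT (fun xi : borel_cV R m => ((xi : 'cV[R]_m) i 0)%:E) /\
    ('E_mu[fun xi : borel_cV R m => ((xi : 'cV[R]_m) i 0)%R] = 0)%E.

Definition subgaussian (R : realType) m (sigma : R)
    (mu : probability (borel_cV R m) R) : Prop :=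
  forall t : 'cV[R]_m,
    ('E_mu[fun xi : borel_cV R m => (expR (dotv t (xi : 'cV[R]_m)))%R]
       <= (expR (sigma ^+ 2 / 2 * norm2 t ^+ 2))%:E)%E.

(* [xhat] is a selection of Argmin_{u in X} ||H^T (A u - omega)||_oo. *)
Definition polyhedral_est (R : realType) m n p (A : 'M[R]_(m, n))
    (X : set 'cV[R]_n) (H : 'M[R]_(m, p)) (xhat : 'cV[R]_m -> 'cV[R]_n) : Prop :=
  forall omega, X (xhat omega) /\
    forall u, X u ->
      `|H^T *m (A *m xhat omega - omega)| <= `|H^T *m (A *m u - omega)|.

(* Probabilities are taken as outer probabilities [mu_ext (Pr x)]: they coincide
   with [Pr x] on Borel events, and they make sense of the risk of estimates that
   are not Borel functions, such as an arbitrary selection of Argmin. *)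
Definition risk (R : realType) m n nu q (eps : R)
    (norm : 'cV[R]_nu -> R) (what : 'cV[R]_m -> 'cV[R]_nu)
    (A : 'M[R]_(m, n)) (Aa : 'I_q -> 'M[R]_(m, n)) (B : 'M[R]_(nu, n))
    (Pr : 'cV[R]_n -> probability (borel_cV R m) R)
    (X : set 'cV[R]_n) (U : set 'cV[R]_q) : \bar R :=
  ereal_sup [set ereal_inf [set rho%:E | rho in [set rho : R |
      (mu_ext (Pr xe.1) [set xi : borel_cV R m |
         (rho < norm (what ((A + pert Aa xe.2) *m xe.1 + (xi : 'cV[R]_m)) - B *m xe.1))%R]
       <= eps%:E)%E]]
    | xe in X `*` U].

(* Main.v *)
Require Import Defs.
From mathcomp Require Import all_boot all_order all_algebra.
From mathcomp Require Import complex.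
From mathcomp Require Import all_classical all_reals all_analysis.
From mathcomp Require Import measurable_realfun.
From mathcomp Require Import ring lra.
Import Order.TTheory GRing.Theory Num.Theory.
Import numFieldNormedType.Exports.
Local Open Scope classical_set_scope.
Local Open Scope ring_scope.

Set Implicit Arguments.
Unset Strict Implicit.
Unset Printing Implicit Defensive.

(* By Chernoff's bound and a union bound over the M L columns h of H, with
   probability at least 1 - eps all the |h^T xi| are below 1/2.  Weak duality for
   the semidefinite program defining rbar bounds |h^T D[eta] x| by 1/2, so that
   ||H^T (A x - omega)||_oo <= 1, and by minimality the estimate xhat satisfies the
   same inequality; hence |h^T A (xhat - x)| <= 2.  Writing xhat - x = 2 P z with
   z = (y' - y)/2, weak duality for the program defining p_+ then bounds
   ||R_l^{1/2} B P z||_2 by rho for each feasible rho.  Convexity of the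
   spectratope is not needed for z: the quadratic form of sum_k T_k^{+,*}[Upsilon_k]
   is positive semidefinite, so its value at z is at most the mean of its values
   at y and y'. *)

(** * Square roots of positive semidefinite matrices *)

Lemma poly_interpolation (F : fieldType) (g : F -> F) (s : seq F) :
  exists p : {poly F}, {in s, forall x, p.[x] = g x}.
Proof.
elim: s => [|a s [p ps]]; first by exists 0.
have [as_|ans] := boolP (a \in s).
  by exists p => x; rewrite inE => /orP[/eqP ->|]; exact: ps.
(* Newton's step: [w] vanishes on [s] but not at [a], so adding a multiple of it corrects the value
   at [a] and leaves the others alone. *)
pose w := \prod_(z <- s) ('X - z%:P).
have wa : w.[a] != 0 by rewrite -/(root w a) root_prod_XsubC.
exists (p + ((g a - p.[a]) / w.[a]) *: w) => x; rewrite inE hornerD hornerZ.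
case/orP => [/eqP ->|xs]; first by rewrite divfK// addrC subrK.
have /rootP -> : root w x by rewrite root_prod_XsubC.
by rewrite mulr0 addr0 ps.
Qed.

Lemma dotvE (R : realType) d (u v : 'cV[R]_d) : dotv u v = \sum_i u i 0 * v i 0.
Proof. by rewrite /dotv mxE; apply: eq_bigr => i _; rewrite mxE. Qed.

Lemma dotvv_ge0 (R : realType) d (u : 'cV[R]_d) : 0 <= dotv u u.
Proof. by rewrite dotvE sumr_ge0// => i _; rewrite -expr2 sqr_ge0. Qed.

Lemma dotvv_eq0 (R : realType) d (u : 'cV[R]_d) : (dotv u u == 0) = (u == 0).
Proof.
apply/eqP/eqP => [|->]; last by rewrite /dotv mulmx0 mxE.
rewrite dotvE => /eqP.
rewrite psumr_eq0 => [/allP u0|i _]; last by rewrite -expr2 sqr_ge0.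
apply/matrixP => i j; rewrite ord1 mxE.
by have := u0 i (mem_index_enum _); rewrite -expr2 sqrf_eq0 => /eqP.
Qed.

Lemma psdmx_eigenvalue_ge0 (R : realType) d (A : 'M[R]_d) (a : R) :
  psdmx A -> eigenvalue A a -> 0 <= a.
Proof.
move=> [_ A_ge0] /eigenvalueP[v vA vn0].
have := A_ge0 v^T; rewrite /qform trmxK vA -scalemxAl mxE pmulr_lge0//.
have -> : (v *m v^T) 0 0 = dotv v^T v^T by rewrite /dotv trmxK.
by rewrite lt_def dotvv_eq0 dotvv_ge0 trmx_eq0 vn0.
Qed.

Lemma symmx_sqr_psd (R : realType) d (W : 'M[R]_d) : symmx W -> psdmx (W *m W).
Proof.
move=> Wsym; split; first by rewrite /symmx trmx_mul Wsym.
move=> u; rewrite /qform.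
have -> : u^T *m (W *m W) *m u = (W *m u)^T *m (W *m u).
  by rewrite trmx_mul Wsym !mulmxA.
exact: dotvv_ge0.
Qed.

(* Over R[i], A = U^-1 D U with D real and nonnegative; if the real polynomial p
   takes the value a^(1/4) at each eigenvalue a, then S = p(A)^2 is the square
   of a real symmetric matrix and S^2 = p(A)^4 = A. *)
Lemma psd_sqrt_exists (R : realType) d (A : 'M[R]_d) :
  psdmx A -> exists S : 'M[R]_d, psdmx S /\ S *m S = A.
Proof.
case: d A => [|d] A Apsd.
  by exists A; split=> //; rewrite [LHS]flatmx0 [RHS]flatmx0.
have Asym : A^T = A by case: Apsd.
pose Ac : 'M[R[i]]_d.+1 := map_mx (real_complex R) A.
have Ac_herm : Ac \is hermsymmx.
  apply: realsym_hermsym.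
    apply/is_hermitianmxP; rewrite expr0 scale1r.
    by apply/matrixP => i j; rewrite !mxE /= -[in LHS]Asym mxE.
  by apply/mxOverP => i j; rewrite mxE; apply/complex_realP; exists (A i j).
have /orthomx_spectralP AcE := hermitian_normalmx Ac_herm.
have U_unit := spectral_unit Ac.
set U := spectralmx Ac in AcE U_unit; set D := spectral_diag Ac in AcE.
pose a i := complex.Re (D 0 i).
have aE i : D 0 i = (a i)%:C%C.
  by rewrite /a RRe_real//; have /mxOverP := hermitian_spectral_diag_real Ac_herm; exact.
have a_ge0 i : 0 <= a i.
  (* The rows of [U] are left eigenvectors of [Ac]; [eigenvalue_map] brings the real eigenvalue
     [a i] back from [Ac] to [A]. *)
  apply: (psdmx_eigenvalue_ge0 Apsd).
  rewrite -(eigenvalue_map (real_complex R)) /= -aE.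
  apply/eigenvalueP; exists (row i U).
    rewrite -row_mul -/Ac AcE !mulmxA mulmxV// mul1mx.
    by apply/rowP => j; rewrite mul_diag_mx !mxE.
  apply/negP => /eqP rowU0; move: U_unit; rewrite -row_free_unit => /row_freeP[V UV].
  have := congr1 (fun V : 'M[R[i]]_d.+1 => V i i) UV.
  have -> : (U *m V) i i = (row i U *m V) 0 i by rewrite -row_mul [RHS]mxE.
  by rewrite rowU0 mul0mx !mxE eqxx => /esym/eqP; rewrite oner_eq0.
have [p pE] := poly_interpolation (fun x => Num.sqrt (Num.sqrt x))
  [seq a i | i <- enum 'I_d.+1].
have pa i : p.[a i] ^+ 4 = a i.
  rewrite pE ?map_f ?mem_enum// -[4%N]/(2 * 2)%N exprM.
  by rewrite sqr_sqrtr ?sqrtr_ge0// sqr_sqrtr.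
pose W := horner_mx A p.
have Wsym : symmx W.
  rewrite /symmx /W; elim/poly_ind: p {pE pa W} => [|p c IH].
    by rewrite rmorph0 trmx0.
  rewrite rmorphD rmorphM /= horner_mx_X horner_mx_C linearD /= tr_scalar_mx.
  rewrite trmx_mul Asym IH; congr (_ + _).
  exact: (comm_mx_horner p (comm_mx_refl A)).
exists (W *m W); split; first exact: symmx_sqr_psd.
have -> : W *m W *m (W *m W) = horner_mx A (p ^+ 4).
  by rewrite rmorphXn /= -[4%N]/(2 * 2)%N exprM !expr2.
(* Over [R[i]], conjugation by [U] reduces the identity to the diagonal entries, where it is
   [pa]. *)
apply: (map_mx_inj (f := real_complex R)).
rewrite map_horner_mx -/Ac [in LHS]AcE horner_mx_uconjC// horner_mx_diag [RHS]AcE.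
congr (_ *m diag_mx _ *m _); apply/rowP => i.
by rewrite mxE aE horner_map /= horner_exp pa.
Qed.

Lemma sqrtmxP (R : realType) d (A : 'M[R]_d) :
  psdmx A -> psdmx (sqrtmx A) /\ sqrtmx A *m sqrtmx A = A.
Proof. by move=> /psd_sqrt_exists; exact: getPex. Qed.

(** Writing X = W^2 with W symmetric gives Tr(XY) = Tr(WYW), and each diagonal entry of WYW is the
    quadratic form of Y at a column of W. *)
Lemma mxtrace_psd_mul_ge0 (R : realType) d (X Y : 'M[R]_d) :
  psdmx X -> psdmx Y -> 0 <= \tr (X *m Y).
Proof.
move=> /psd_sqrt_exists[W [[Wsym _] <-]] [_ Y_ge0].
rewrite -mulmxA mxtrace_mulC /mxtrace sumr_ge0// => i _.
have -> : (W *m Y *m W) i i = qform Y (col i W).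
  rewrite /qform tr_col Wsym -!mulmxA !mxE; apply: eq_bigr => j _.
  by rewrite !mxE; congr (_ * _); apply: eq_bigr => k _; rewrite !mxE.
exact: Y_ge0.
Qed.

(** * Quadratic forms and semidefinite block matrices *)

Lemma qformD (R : realType) d (A B : 'M[R]_d) u :
  qform (A + B) u = qform A u + qform B u.
Proof. by rewrite /qform mulmxDr mulmxDl mxE. Qed.

Lemma qform_sum (R : realType) d (I : finType) (A : I -> 'M[R]_d) u :
  qform (\sum_i A i) u = \sum_i qform (A i) u.
Proof. by rewrite /qform mulmx_sumr mulmx_suml summxE. Qed.

Lemma qformZ (R : realType) d (A : 'M[R]_d) a u :
  qform A (a *: u) = a ^+ 2 * qform A u.
Proof.
by rewrite /qform -scalemxAr linearZ /= -!scalemxAl scalerA mxE -expr2.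
Qed.

Lemma qform_scalar (R : realType) d (a : R) (u : 'cV[R]_d) :
  qform a%:M u = a * dotv u u.
Proof. by rewrite /qform mul_mx_scalar -scalemxAl mxE. Qed.

Lemma qform_parallelogram (R : realType) d (A : 'M[R]_d) u v :
  qform A (u + v) + qform A (u - v) = 2 * (qform A u + qform A v).
Proof.
rewrite /qform !mulmxDr !mulmxN [(u + v)^T]linearD [(u - v)^T]linearB /=.
rewrite !mulmxBl !mulmxDl.
by rewrite !mxE; ring.
Qed.

(** The parallelogram identity, after dropping the nonnegative value at u + v. *)
Lemma qform_midpoint (R : realType) d (A : 'M[R]_d) u v :
  (forall w, 0 <= qform A w) ->
  qform A (2^-1 *: (u - v)) <= 2^-1 * (qform A u + qform A v).
Proof.
move=> A_ge0; have := qform_parallelogram A u v; have := A_ge0 (u + v).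
by rewrite qformZ; lra.
Qed.

(** This is the weak duality step for both programs: the block form is evaluated at [u; v] and at
    [u; -v], and the two signs of the cross term give the absolute value. *)
Lemma psd_block_cross_le (R : realType) p q (A : 'M[R]_p) (B : 'M[R]_(p, q))
    (C : 'M[R]_(q, p)) (D : 'M[R]_q) (u : 'cV[R]_p) (v : 'cV[R]_q) :
  psdmx (block_mx A B C D) ->
  2 * `|(u^T *m B *m v) 0 0| <= qform A u + qform D v.
Proof.
move=> [sym pos].
have /eq_block_mx[_ _ BC _] : block_mx A^T C^T B^T D^T = block_mx A B C D.
  by rewrite -tr_block_mx.
have qE w : qform (block_mx A B C D) (col_mx u w)
    = qform A u + qform D w + 2 * (u^T *m B *m w) 0 0.
  rewrite /qform tr_col_mx mul_row_block mul_row_col !mulmxDl.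
  have -> : w^T *m C *m u = (u^T *m B *m w)^T.
    by rewrite !trmx_mul trmxK BC mulmxA.
  by rewrite !mxE; ring.
have := pos (col_mx u v); have := pos (col_mx u (- v)).
have -> : - v = (-1) *: v by rewrite scaleN1r.
rewrite !qE -scalemxAr [((-1) *: (_ *m _)) 0 0]mxE qformZ sqrrN expr1n mul1r mulN1r.
move: ((u^T *m B *m v) 0 0) => b.
by move=> neg_le pos_le; case: (ger0P b); lra.
Qed.

(** * Spectratopes and support functions *)

(** [spec_adj] is the adjoint of the quadratic map y -> T_k[y]^2 for the trace pairing. *)
Lemma qform_spec_adj (R : realType) N K (f : 'I_K -> nat)
    (T : forall k, 'I_N -> 'M[R]_(f k)) k (X : 'M[R]_(f k)) (y : 'cV[R]_N) :
  qform (spec_adj T X) y = \tr (X *m (spec_lin T k y *m spec_lin T k y)).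
Proof.
rewrite /qform /spec_lin -mulmxA mxE mulmx_suml mulmx_sumr raddf_sum /=.
apply: eq_bigr => i _.
rewrite 2!mulmx_sumr raddf_sum /= !mxE mulr_sumr; apply: eq_bigr => j _.
by rewrite mxE -!scalemxAl -!scalemxAr scalerA mxtraceZ mulmxA; ring.
Qed.

Lemma symmx_spec_lin (R : realType) N K (f : 'I_K -> nat)
    (T : forall k, 'I_N -> 'M[R]_(f k)) k (y : 'cV[R]_N) :
  (forall k j, symmx (T k j)) -> symmx (spec_lin T k y).
Proof.
move=> Tsym; rewrite /symmx /spec_lin raddf_sum /=.
by apply: eq_bigr => j _; rewrite linearZ /= Tsym.
Qed.

Lemma qform_spec_adj_sum_ge0 (R : realType) N K (f : 'I_K -> nat)
    (T : forall k, 'I_N -> 'M[R]_(f k)) (X : forall k, 'M[R]_(f k)) :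
  (forall k j, symmx (T k j)) -> (forall k, psdmx (X k)) ->
  forall y, 0 <= qform (\sum_k spec_adj T (X k)) y.
Proof.
move=> Tsym Xpsd y; rewrite qform_sum sumr_ge0// => k _; rewrite qform_spec_adj.
by apply: mxtrace_psd_mul_ge0 => //; apply/symmx_sqr_psd/symmx_spec_lin.
Qed.

Lemma ler_mx_entry (R : realType) m n (x : 'M[R]_(m, n)) i j :
  `|x i j| <= `|x|.
Proof.
by rewrite [leRHS]/Num.Def.normr/= mx_normrE (le_bigmax _ _ (i, j)).
Qed.

Lemma mx_norm_le (R : realType) m n (x : 'M[R]_(m, n)) c :
  0 <= c -> (forall i j, `|x i j| <= c) -> `|x| <= c.
Proof.
by move=> c0 xc; rewrite [leLHS]/Num.Def.normr/= mx_normrE bigmax_le.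
Qed.

(** Compactness bounds the entries of the vectors in [C], hence the linear form on [C], so that
    [sup] is a genuine upper bound. *)
Lemma ge_support_fun (R : realType) d (C : set 'cV[R]_d) y u :
  compact C -> C u -> dotv y u <= support_fun C y.
Proof.
move=> Ccpt Cu; apply: ub_le_sup; last by exists u.
have [M [_ /(_ (M + 1))]] := compact_bounded Ccpt.
rewrite ltrDl ltr01 => /(_ isT) C_le.
exists (\sum_i `|y i 0| * (M + 1)) => _ [v Cv <-].
rewrite dotvE; apply: ler_sum => i _.
rewrite (le_trans (ler_norm _))// normrM ler_wpM2l// (le_trans _ (C_le _ Cv))//.
exact: ler_mx_entry.
Qed.

(* <X_k, T_k[y]^2> <= t_k Tr X_k, since both X_k and t_k I - T_k[y]^2 are
   positive semidefinite. *)
Lemma qform_spec_adj_sum_le (R : realType) N K (f : 'I_K -> nat)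
    (T : forall k, 'I_N -> 'M[R]_(f k)) TT (X : forall k, 'M[R]_(f k)) y :
  compact TT -> (forall k, psdmx (X k)) -> basic_spectratope T TT y ->
  qform (\sum_k spec_adj T (X k)) y <= support_fun TT (trvec X).
Proof.
move=> TTcpt Xpsd [t TTt yt].
apply: le_trans (ge_support_fun (trvec X) TTcpt TTt).
rewrite qform_sum dotvE; apply: ler_sum => k _; rewrite qform_spec_adj mxE.
have := mxtrace_psd_mul_ge0 (Xpsd k) (yt k).
by rewrite mulmxBr mul_mx_scalar linearB /= mxtraceZ subr_ge0 mulrC.
Qed.

(** * Tail and union bounds for the noise *)

Lemma measurable_coord (R : realType) m (i : 'I_m) :
  measurable_fun setT (fun xi : borel_cV R m => (xi : 'cV[R]_m) i 0).
Proof.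
apply: (measurability _ (RGenOInfty.measurableE R)) => _ [_ [a ->]] <-.
rewrite setTI; apply: sub_sigma_algebra.
rewrite preimage_itvoy.
apply: (@open_comp _ _ (fun x : 'cV[R]_m => x i 0) [set y | a < y]).
  by move=> x _; exact: coord_continuous.
exact: open_gt.
Qed.

Lemma measurable_dotv (R : realType) m (h : 'cV[R]_m) :
  measurable_fun setT (fun xi : borel_cV R m => dotv h (xi : 'cV[R]_m)).
Proof.
under eq_fun do rewrite dotvE.
apply: measurable_sum => i; apply: measurable_funM; first exact: measurable_cst.
exact: measurable_coord.
Qed.

Lemma dotvZl (R : realType) m a (u v : 'cV[R]_m) : dotv (a *: u) v = a * dotv u v.
Proof. by rewrite /dotv linearZ /= -scalemxAl mxE. Qed.

Lemma dotvC (R : realType) m (u v : 'cV[R]_m) : dotv u v = dotv v u.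
Proof. by rewrite !dotvE; apply: eq_bigr => i _; rewrite mulrC. Qed.

Lemma sqr_norm2 (R : realType) m (u : 'cV[R]_m) : norm2 u ^+ 2 = dotv u u.
Proof. by rewrite sqr_sqrtr// dotvv_ge0. Qed.

Lemma norm2N (R : realType) m (u : 'cV[R]_m) : norm2 (- u) = norm2 u.
Proof.
by rewrite /norm2 -scaleN1r dotvZl dotvC dotvZl mulrA mulrNN !mul1r.
Qed.

(** The moment generating function of h^T xi at s is the sub-Gaussian expectation at t = s h. *)
Lemma subgaussian_chernoff (R : realType) m (sigma : R)
    (mu : probability (borel_cV R m) R) (h : 'cV[R]_m) (s a : R) :
  subgaussian sigma mu -> 0 < s ->
  (mu [set xi | (a <= dotv h (xi : 'cV[R]_m))%R]
     <= (expR (sigma ^+ 2 / 2 * s ^+ 2 * norm2 h ^+ 2 - s * a))%:E)%E.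
Proof.
move=> sub s_gt0.
pose X : {RV mu >-> R} := mfun_Sub (mem_set (measurable_dotv h)).
apply: (le_trans (chernoff X a s_gt0)).
rewrite expRD EFinM; apply: lee_wpmul2r; first by rewrite lee_fin expR_ge0.
have -> : sigma ^+ 2 / 2 * s ^+ 2 * norm2 h ^+ 2
    = sigma ^+ 2 / 2 * norm2 (s *: h) ^+ 2.
  by rewrite !sqr_norm2 dotvZl dotvC dotvZl; ring.
have := sub (s *: h); congr (_ <= _)%E; rewrite /mmt_gen_fun.
congr ('E_mu[_])%E; apply/funext => xi /=; by rewrite dotvZl mulrC.
Qed.

Lemma measurable_dotv_ge (R : realType) m (h : 'cV[R]_m) a :
  measurable [set xi : borel_cV R m | a <= dotv h (xi : 'cV[R]_m)].
Proof.
rewrite -[X in measurable X]setTI.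
exact: measurable_fun_le (measurable_cst _) (measurable_dotv h).
Qed.

(** The two-sided event splits into one-sided ones for h and -h, which have the same norm; each will
    cost delta/2. *)
Lemma dotv_abs_ge_setU (R : realType) m (h : 'cV[R]_m) a :
  [set xi : borel_cV R m | a <= `|dotv h (xi : 'cV[R]_m)|]
  = [set xi : borel_cV R m | a <= dotv h (xi : 'cV[R]_m)]
    `|` [set xi : borel_cV R m | a <= dotv (- h) (xi : 'cV[R]_m)].
Proof.
apply/seteqP; split=> xi /=; rewrite -scaleN1r dotvZl mulN1r ler_normr.
  by case/orP; [left|right].
by case=> ->; rewrite ?orbT.
Qed.

Lemma measurable_dotv_abs_ge (R : realType) m (h : 'cV[R]_m) a :
  measurable [set xi : borel_cV R m | a <= `|dotv h (xi : 'cV[R]_m)|].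
Proof.
by rewrite dotv_abs_ge_setU; apply: measurableU; exact: measurable_dotv_ge.
Qed.

(* Chernoff's bound at s = 4 ln(2/delta), which is optimal for the largest
   admissible norm of h. *)
Lemma subgaussian_tail (R : realType) m (sigma delta : R)
    (mu : probability (borel_cV R m) R) (h : 'cV[R]_m) :
  0 < sigma -> 0 < delta -> delta <= 1 -> subgaussian sigma mu ->
  norm2 h <= (2 * sigma * Num.sqrt (2 * ln (2 / delta)))^-1 ->
  (mu [set xi | (2^-1 <= dotv h (xi : 'cV[R]_m))%R] <= (delta / 2)%:E)%E.
Proof.
move=> sigma_gt0 delta_gt0 delta_le1 sub; set l := ln (2 / delta) => h_le.
have l_gt0 : 0 < l by rewrite ln_gt0// ltr_pdivlMr//; lra.
have s_gt0 : 0 < 4 * l by rewrite mulr_gt0.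
apply: le_trans (subgaussian_chernoff h 2^-1 sub s_gt0) _.
have -> : delta / 2 = expR (- l).
  by rewrite expRN lnK ?posrE ?divr_gt0// invf_div.
rewrite lee_fin ler_expR.
have c_ge0 : 0 <= norm2 h by exact: sqrtr_ge0.
have r_gt0 : 0 < Num.sqrt (2 * l) by rewrite sqrtr_gt0 mulr_gt0.
have rE : Num.sqrt (2 * l) ^+ 2 = 2 * l by rewrite sqr_sqrtr// mulr_ge0// ltW.
have {}h_le : norm2 h * (2 * sigma * Num.sqrt (2 * l)) <= 1.
  by rewrite -ler_pdivlMr ?div1r// !mulr_gt0.
have : (norm2 h * (2 * sigma * Num.sqrt (2 * l))) ^+ 2 <= 1.
  by rewrite expr_le1// !mulr_ge0// ltW.
rewrite !exprMn rE => sqr_le1.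
(* At s = 4l and a = 1/2 the Chernoff exponent is 8 sigma^2 l^2 |h|^2 - 2l; this inequality bounds
   the first term by l. *)
have : l * (norm2 h ^+ 2 * (2 ^+ 2 * sigma ^+ 2 * (2 * l))) <= l * 1.
  by rewrite ler_pM2l.
by lra.
Qed.

Lemma subgaussian_abs_tail (R : realType) m (sigma delta : R)
    (mu : probability (borel_cV R m) R) (h : 'cV[R]_m) :
  0 < sigma -> 0 < delta -> delta <= 1 -> subgaussian sigma mu ->
  norm2 h <= (2 * sigma * Num.sqrt (2 * ln (2 / delta)))^-1 ->
  (mu [set xi | (2^-1 <= `|dotv h (xi : 'cV[R]_m)|)%R] <= delta%:E)%E.
Proof.
move=> sigma_gt0 delta_gt0 delta_le1 sub h_le; rewrite dotv_abs_ge_setU.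
apply: le_trans (measureU2 _ _ _) _; [exact: measurable_dotv_ge..|].
rewrite [delta]splitr EFinD; apply: leeD;
  by apply: (subgaussian_tail sigma_gt0) => //; rewrite norm2N.
Qed.

Lemma measure_bigsetU_le d (X : measurableType d) (R : realType)
    (mu : {measure set X -> \bar R}) (I : finType) (F : I -> set X) :
  (forall i, measurable (F i)) ->
  (mu (\big[setU/set0]_i F i) <= \sum_i mu (F i))%E.
Proof.
(* Measurability of the partial unions is carried through the induction, since subadditivity asks
   for it at each step. *)
move=> mF; apply: (proj2 (A := measurable (\big[setU/set0]_i F i))).
elim/big_rec2: _ => [|i x A _ [mA muA]]; first by rewrite measure0.
split; first exact: measurableU.
exact: le_trans (measureU2 _ _ _) (leeD _ _).
Qed.

(** * Bias caused by the perturbation of the observation matrix *)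

Lemma dotv_pert (R : realType) m n q (Aa : 'I_q -> 'M[R]_(m, n))
    (h : 'cV[R]_m) (eta : 'cV[R]_q) (x : 'cV[R]_n) :
  dotv h (pert Aa eta *m x) = (eta^T *m contrast_mx Aa h *m x) 0 0.
Proof.
rewrite /dotv /pert mulmxA mulmx_sumr; congr ((_ *m x) 0 0).
rewrite mulmx_sum_row; apply: eq_bigr => a _.
by rewrite -scalemxAr mxE rowK.
Qed.

(** The bias is the cross term of the semidefinite block at (v, y); the support functions bound the
    two diagonal forms, and the factor 2 on the cross term accounts for the 1/2 in the objective. *)
Lemma bias_le_rbar_vals (R : realType) m n q N K (f : 'I_K -> nat)
    M' L' (d : 'I_L' -> nat) (Aa : 'I_q -> 'M[R]_(m, n))
    (P : 'M[R]_(n, N)) (T : forall k, 'I_N -> 'M[R]_(f k)) (TT : set 'cV[R]_K)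
    (Q : 'M[R]_(q, M')) (S : forall i, 'I_M' -> 'M[R]_(d i)) (SS : set 'cV[R]_L')
    (h : 'cV[R]_m) y v r :
  compact TT -> compact SS ->
  basic_spectratope T TT y -> basic_spectratope S SS v ->
  rbar_vals Aa P T TT Q S SS h r ->
  `|dotv h (pert Aa (Q *m v) *m (P *m y))| <= r.
Proof.
move=> TTcpt SScpt Yy Vv [La [Up [La_psd Up_psd blk ->]]].
have := psd_block_cross_le v y blk.
have -> : v^T *m (Q^T *m contrast_mx Aa h *m P) *m y
    = (Q *m v)^T *m contrast_mx Aa h *m (P *m y).
  by rewrite trmx_mul !mulmxA.
rewrite -dotv_pert.
have := qform_spec_adj_sum_le TTcpt La_psd Yy.
have := qform_spec_adj_sum_le SScpt Up_psd Vv.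
by lra.
Qed.

Lemma bias_le_rbar (R : realType) m n q N K (f : 'I_K -> nat)
    M' L' (d : 'I_L' -> nat) (Aa : 'I_q -> 'M[R]_(m, n))
    (P : 'M[R]_(n, N)) (T : forall k, 'I_N -> 'M[R]_(f k)) (TT : set 'cV[R]_K)
    (Q : 'M[R]_(q, M')) (S : forall i, 'I_M' -> 'M[R]_(d i)) (SS : set 'cV[R]_L')
    (h : 'cV[R]_m) x eta :
  compact TT -> compact SS ->
  spectratope P T TT x -> spectratope Q S SS eta ->
  (`|dotv h (pert Aa eta *m x)|%:E <= rbar Aa P T TT Q S SS h)%E.
Proof.
move=> TTcpt SScpt [y Yy <-] [v Vv <-].
apply: le_ereal_inf_tmp => _ [r r_val <-]; rewrite lee_fin.
exact: bias_le_rbar_vals r_val.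
Qed.

(** * Recovery error from a feasible point of the program for [pplus] *)

Lemma qform_gram_diag (R : realType) m M N (H : 'M[R]_(m, M)) (G : 'M[R]_(m, N))
    (ups : 'rV[R]_M) z :
  qform (G^T *m H *m diag_mx ups *m H^T *m G) z
  = \sum_j ups 0 j * dotv (col j H) (G *m z) ^+ 2.
Proof.
have colE j : (H^T *m (G *m z)) j 0 = dotv (col j H) (G *m z).
  by rewrite dotvE mxE; apply: eq_bigr => i _; rewrite !mxE.
rewrite /qform.
have -> : z^T *m (G^T *m H *m diag_mx ups *m H^T *m G) *m z
    = (H^T *m (G *m z))^T *m (diag_mx ups *m (H^T *m (G *m z))).
  by rewrite !trmx_mul trmxK !mulmxA.
move: (H^T *m (G *m z)) colE => X colE.
rewrite mul_diag_mx mxE; apply: eq_bigr => j _.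
by rewrite !mxE colE; ring.
Qed.

Lemma norm2_sqrtmx (R : realType) d (A : 'M[R]_d) u :
  psdmx A -> norm2 (sqrtmx A *m u) = Num.sqrt (qform A u).
Proof.
move=> /sqrtmxP[[Wsym _] WW]; rewrite /norm2 /dotv /qform -[in RHS]WW.
by rewrite trmx_mul Wsym !mulmxA.
Qed.

(** Each seminorm of B P z is the Euclidean norm of [g l], hence the largest pairing of [g l] with a
    unit vector w; the block inequality at (w, z) bounds all these pairings by rho. *)
Lemma pplus_error_le (R : realType) m n nu N K (f : 'I_K -> nat) L M
    (A : 'M[R]_(m, n)) (B : 'M[R]_(nu, n)) (Rl : 'I_L -> 'M[R]_nu)
    (P : 'M[R]_(n, N)) (T : forall k, 'I_N -> 'M[R]_(f k)) (TT : set 'cV[R]_K)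
    (H : 'I_L -> 'M[R]_(m, M)) rho x x' :
  (0 < nu)%N -> (0 < L)%N -> (forall l, psdmx (Rl l)) ->
  (forall k j, symmx (T k j)) -> compact TT ->
  pplus_feas A B Rl P T TT H rho ->
  spectratope P T TT x -> spectratope P T TT x' ->
  (forall l j, `|dotv (col j (H l)) (A *m (x' - x))| <= 2) ->
  maxnorm Rl (B *m (x' - x)) <= 2 * rho.
Proof.
move=> nu_gt0 L_gt0 Rl_psd Tsym TTcpt [lam [Up [ups feas]]] [y Yy <-] [y' Yy' <-].
rewrite -mulmxBr; pose z := 2^-1 *: (y' - y).
have -> : y' - y = 2 *: z by rewrite scalerA divff ?scale1r.
rewrite -scalemxAr => Hz.
have {}Hz l j : dotv (col j (H l)) (A *m P *m z) ^+ 2 <= 1.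
  have := Hz l j; rewrite -scalemxAr mulmxA dotvC dotvZl dotvC normrM normr_nat.
  by rewrite ger_pMr// -[_ ^+ 2]real_normK ?num_real// => h1; rewrite expr_le1.
pose g l := sqrtmx (Rl l) *m (B *m P *m z).
have unit_le l w : dotv w w = 1 -> `|dotv w (g l)| <= rho.
  move=> ww; have [ups_ge0 Up_psd le_rho blk] := feas l.
  have := psd_block_cross_le w z blk.
  rewrite qform_scalar ww mulr1 qformD -!mulmxA.
  have -> : P^T *m (A^T *m (H l *m (diag_mx (ups l) *m ((H l)^T *m (A *m P)))))
     = (A *m P)^T *m H l *m diag_mx (ups l) *m (H l)^T *m (A *m P).
    by rewrite trmx_mul !mulmxA.
  rewrite qform_gram_diag.
  (* The 1/2 in the off-diagonal block cancels the 2 of the cross term inequality. *)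
  have -> : w^T *m (2^-1 *: (sqrtmx (Rl l) *m (B *m P)) *m z)
      = 2^-1 *: (w^T *m g l).
    by rewrite -scalemxAl -scalemxAr /g !mulmxA.
  rewrite mxE normrM ger0_norm// mulrA divff// mul1r -/(dotv w (g l)).
  have : \sum_j ups l 0 j * dotv (col j (H l)) (A *m P *m z) ^+ 2 <= \sum_j ups l 0 j.
    by apply: ler_sum => j _; rewrite ler_piMr.
  have := qform_midpoint y' y (qform_spec_adj_sum_ge0 Tsym Up_psd).
  have := qform_spec_adj_sum_le TTcpt Up_psd Yy.
  have := qform_spec_adj_sum_le TTcpt Up_psd Yy'.
  by rewrite -/z; lra.
(* A block and a unit vector exist because [L] and [nu] are positive; the sign of rho handles the
   base value 0 of the maximum. *)
have rho_ge0 : 0 <= rho.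
  apply: le_trans (unit_le (Ordinal L_gt0) (delta_mx (Ordinal nu_gt0) 0) _) => //.
  rewrite dotvE (bigD1 (Ordinal nu_gt0))//= big1 => [|i /negPf ni].
    by rewrite mxE !eqxx mulr1 addr0.
  by rewrite mxE ni mul0r.
apply: bigmax_le => [|l _]; first by rewrite mulr_ge0.
rewrite -norm2_sqrtmx// -!(scalemxAr 2) [B *m (P *m z)]mulmxA -/(g l).
have -> : norm2 (2 *: g l) = 2 * norm2 (g l).
  rewrite /norm2 dotvZl dotvC dotvZl mulrA -expr2 sqrtrM ?sqr_ge0//.
  by rewrite sqrtr_sqr ger0_norm.
(* The unit vector is g/|g|, so the case g = 0 is set apart. *)
rewrite ler_pM2l//; have [->//|g_neq0] := eqVneq (norm2 (g l)) 0.
have := unit_le l ((norm2 (g l))^-1 *: g l).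
rewrite dotvZl dotvC dotvZl -sqr_norm2 => /(_ _)/(le_trans (ler_norm _)).
have -> : (norm2 (g l))^-1 * norm2 (g l) ^+ 2 = norm2 (g l).
  by rewrite expr2 mulKf.
by apply; rewrite mulVf.
Qed.

(** * Stacked contrast matrix and the risk bound *)

Lemma dotvDr (R : realType) m (u v w : 'cV[R]_m) :
  dotv u (v + w) = dotv u v + dotv u w.
Proof. by rewrite /dotv mulmxDr mxE. Qed.

Lemma dotvNr (R : realType) m (u v : 'cV[R]_m) : dotv u (- v) = - dotv u v.
Proof. by rewrite /dotv mulmxN mxE. Qed.

Lemma mul_tr_mxrow (R : realType) m L M (H : 'I_L -> 'M[R]_(m, M)) v i :
  ((\mxrow_(l < L) H l)^T *m v) i 0
  = dotv (col (tagnat.sig2 i) (H (tagnat.sig1 i))) v.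
Proof. by rewrite dotvE mxE; apply: eq_bigr => k _; rewrite !mxE. Qed.

Lemma dotv_mxrow_le (R : realType) m L M (H : 'I_L -> 'M[R]_(m, M)) v l j :
  `|dotv (col j (H l)) v| <= `|(\mxrow_(l < L) H l)^T *m v|.
Proof.
have -> : dotv (col j (H l)) v
    = ((\mxrow_(l < L) H l)^T *m v) (tagnat.Rank l j) 0.
  rewrite mxE dotvE; apply: eq_bigr => k _.
  by rewrite -[in LHS](mxrowK H l) /submxrow !mxE.
exact: ler_mx_entry.
Qed.

Theorem proposition3p3 (R : realType) (m n nu q N K M' L' L M : nat)
    (* observation model and recovery norm *)
    (A : 'M[R]_(m, n)) (Aa : 'I_q -> 'M[R]_(m, n)) (B : 'M[R]_(nu, n))
    (Rl : 'I_L -> 'M[R]_nu) (sigma : R)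
    (Pr : 'cV[R]_n -> probability (borel_cV R m) R)
    (* signal set *)
    (P : 'M[R]_(n, N)) (f : 'I_K -> nat) (T : forall k, 'I_N -> 'M[R]_(f k))
    (TT : set 'cV[R]_K)
    (* uncertainty set *)
    (Q : 'M[R]_(q, M')) (d : 'I_L' -> nat) (S : forall i, 'I_M' -> 'M[R]_(d i))
    (SS : set 'cV[R]_L')
    (* contrast matrix, tolerance, and estimate *)
    (H : 'I_L -> 'M[R]_(m, M)) (eps : R) (xhat : 'cV[R]_m -> 'cV[R]_n)
    (nu_gt0 : (0 < nu)%N) (L_gt0 : (0 < L)%N) (M_gt0 : (0 < M)%N)
    (Rl_psd : forall l, psdmx (Rl l)) (Rl_pd : pdmx (\sum_(l < L) Rl l))
    (T_data : spectratope_data T TT) (S_data : spectratope_data S SS)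
    (sigma_gt0 : 0 < sigma)
    (Pr_mean : forall x, spectratope P T TT x -> zero_mean (Pr x))
    (Pr_subg : forall x, spectratope P T TT x -> subgaussian sigma (Pr x))
    (eps_gt0 : 0 < eps) (eps_lt1 : eps < 1)
    (H_norm : forall l j, let delta := eps / (M * L)%:R in
      norm2 (col j (H l)) <= (2 * sigma * Num.sqrt (2 * ln (2 / delta)))^-1)
    (H_rbar : forall l j,
      (rbar Aa P T TT Q S SS (col j (H l)) <= (2^-1)%:E)%E)
    (xhat_est : polyhedral_est A (spectratope P T TT) (\mxrow_(l < L) H l) xhat) :
  (risk eps (maxnorm Rl) (fun omega => B *m xhat omega)%R A Aa B Pr
      (spectratope P T TT) (spectratope Q S SS)
    <= pplus A B Rl P T TT H)%E.
Proof.
have [Tsym _ _ _ [TTcpt _ _]] := T_data.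
have [_ _ _ _ [SScpt _ _]] := S_data.
have ML_gt0 : 0 < (M * L)%:R :> R by rewrite ltr0n muln_gt0 M_gt0.
pose delta := eps / (M * L)%:R.
have delta_gt0 : 0 < delta by rewrite divr_gt0.
have delta_le1 : delta <= 1.
  by rewrite ler_pdivrMr// mul1r (le_trans (ltW eps_lt1))// ler1n muln_gt0 M_gt0.
apply: ge_ereal_sup => _ [[x eta] [/= Xx Ueta] <-].
(* Moving the factor 2 across exposes the infimum, so it suffices that 2 rho is an admissible error
   level for every feasible rho. *)
rewrite -lee_pdivrMl//; apply: le_ereal_inf_tmp => _ [rho feas <-].
rewrite lee_pdivrMl// -EFinM; apply: ereal_inf_lbound; exists (2 * rho) => //=.
pose big_noise (lj : 'I_L * 'I_M) := [set xi : borel_cV R m |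
  2^-1 <= `|dotv (col lj.2 (H lj.1)) (xi : 'cV[R]_m)|].
have m_noise lj : measurable (big_noise lj) by exact: measurable_dotv_abs_ge.
(* The error event may fail to be Borel, as [xhat] is an arbitrary selection; it is covered by the
   measurable union of the large noise events. *)
apply: (@le_trans _ _ (mu_ext (Pr x) (\big[setU/set0]_lj big_noise lj))).
  apply: le_mu_ext => xi /=; apply: contraPP => noise.
  have {}noise l j : `|dotv (col j (H l)) (xi : 'cV[R]_m)| < 2^-1.
    rewrite ltNge; apply/negP => h; apply: noise.
    by rewrite -classical_sets.bigcup_seq; exists (l, j) => //=; rewrite mem_index_enum.
  apply/negP; rewrite -leNgt -mulmxBr.
  set omega := _ + (xi : 'cV[R]_m).
  have [Xxhat xhat_min] := xhat_est omega.
  apply: (pplus_error_le nu_gt0 L_gt0 Rl_psd Tsym TTcpt feas Xx Xxhat) => l j.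
  (* At the true signal the residual is minus the bias and the noise, each at most 1/2 in absolute
     value against every column. *)
  have resid_le1 : `|(\mxrow_(l < L) H l)^T *m (A *m x - omega)| <= 1.
    apply: mx_norm_le => // i i0; rewrite (ord1 i0) mul_tr_mxrow.
    set l' := tagnat.sig1 i; set h := col _ (H l').
    have -> : A *m x - omega = - (pert Aa eta *m x + xi).
      by rewrite /omega mulmxDl -addrA opprD addrA subrr sub0r.
    have := le_trans (bias_le_rbar Aa h TTcpt SScpt Xx Ueta) (H_rbar l' (tagnat.sig2 i)).
    rewrite lee_fin -/h => bias.
    rewrite dotvNr dotvDr normrN (le_trans (ler_normD _ _))//.
    have := noise l' (tagnat.sig2 i); rewrite -/h; lra.
  have := le_trans (dotv_mxrow_le H _ l j) resid_le1.
  (* The true x competes in the minimization, so the residual at [xhat omega] is also at most 1; the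
     two residuals differ by A (xhat - x). *)
  have := le_trans (dotv_mxrow_le H _ l j) (le_trans (xhat_min _ Xx) resid_le1).
  have -> : A *m (xhat omega - x) = (A *m xhat omega - omega) - (A *m x - omega).
    by rewrite mulmxBr opprB addrA subrK.
  rewrite [in X in _ -> _ -> X]dotvDr dotvNr => h1 h2.
  by rewrite (le_trans (ler_normB _ _))//; lra.
rewrite measurable_mu_extE; last exact: bigsetU_measurable.
apply: le_trans (measure_bigsetU_le _ m_noise) _.
apply: (@le_trans _ _ (\sum_(lj : 'I_L * 'I_M) delta%:E)).
  apply: lee_sum => lj _; apply: (subgaussian_abs_tail sigma_gt0) => //.
    exact: Pr_subg.
(* The M L events of probability at most delta add up to M L delta = eps. *)
rewrite sumEFin lee_fin sumr_const card_prod !card_ord mulnC -mulr_natr.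
by rewrite divfK// gt_eqF.
Qed.
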